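(* Let $m$ be a positive integer and let $s_1,\dots,s_m$ be real numbers in the open interval $0<s<1$. Then \[ \lim_{x\to 1^-} \sqrt{1-x}\, \sum_{n=0}^\infty \frac{(\tfrac12)_n (s_1)_n(1-s_1)_n\cdots (s_m)_n(1-s_m)_n}{n!^{2m+1}}\,n^m x^n = \prod_{j=1}^m \frac{\sin\pi s_j}{\pi}. \]
   Context: For real $s$ and a nonnegative integer $n$, $(s)_n=\Gamma(s+n)/\Gamma(s)=\prod_{k=0}^{n-1}(s+k)$ denotes the Pochhammer symbol (shifted factorial); in particular $(1)_n=n!$. The power series in $x$ converges for $|x|<1$, and the limit is taken as $x$ tends to $1$ from below along real values. *)

(* Defs.v *)
From Stdlib Require Import Reals Factorial Lra Lia.
From Coquelicot Require Import Coquelicot.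
Open Scope R_scope.

(* f 0 * ... * f (n - 1); unlike Stdlib's prod_f_R0, the product over n = 0
   indices is 1. *)
Fixpoint Rprod (n : nat) (f : nat -> R) : R :=
  match n with
  | O => 1
  | S k => Rprod k f * f k
  end.

Definition pochhammer (s : R) (n : nat) : R := Rprod n (fun k => s + INR k).

Lemma pochhammer_bound (s : R) (n : nat) :
  0 < s < 1 -> 0 < pochhammer s n <= INR (fact n).
Proof.
  intros Hs; induction n as [|n IH]; unfold pochhammer in *.
  - simpl; lra.
  - rewrite fact_simpl, mult_INR, S_INR; simpl.
    pose proof (pos_INR n).
    split; nra.
Qed.

Lemma Rprod_pochhammer_bound (m n : nat) (s : nat -> R) :
  (forall j : nat, (j < m)%nat -> 0 < s j < 1) ->
  0 < Rprod m (fun j => pochhammer (s j) n * pochhammer (1 - s j) n)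
    <= INR (fact n) ^ (2 * m).
Proof.
  intros Hs; induction m as [|m IH].
  - simpl; lra.
  - destruct IH as [H1 H2]; [intros j Hj; apply Hs; lia|].
    replace (2 * S m)%nat with (S (S (2 * m)))%nat by lia.
    cbn [Rprod]; rewrite <- !tech_pow_Rmult.
    destruct (pochhammer_bound (s m) n) as [A1 A2]; [apply Hs; lia|].
    destruct (pochhammer_bound (1 - s m) n) as [B1 B2];
      [specialize (Hs m ltac:(lia)); lra|].
    set (a := pochhammer (s m) n) in *; set (b := pochhammer (1 - s m) n) in *.
    set (F := INR (fact n)) in *; set (P := Rprod m _) in *.
    split; [repeat apply Rmult_lt_0_compat; assumption|].
    replace (F * (F * F ^ (2 * m))) with (F ^ (2 * m) * (F * F)) by ring.
    apply Rmult_le_compat; try nra.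
Qed.

Lemma ex_series_pow_geom (m : nat) (x : R) :
  Rabs x < 1 -> ex_series (fun n => INR n ^ m * Rabs x ^ n).
Proof.
  intros Hx.
  destruct (Req_dec x 0) as [->|Hx0].
  - apply ex_series_incr_1.
    apply (ex_series_ext (fun n => 0 * (/ 2) ^ n)).
    + intros n; rewrite Rabs_R0; simpl; ring.
    + apply (ex_series_scal_l 0 (fun n => (/ 2) ^ n)), ex_series_geom.
      rewrite Rabs_pos_eq; lra.
  - assert (Hp : 0 < Rabs x) by (apply Rabs_pos_lt; assumption).
    apply ex_series_incr_1, ex_series_Rabs.
    apply ex_series_DAlembert with (k := Rabs x); [assumption| |].
    + intros n; apply Rgt_not_eq, Rmult_lt_0_compat; apply pow_lt; [|assumption].
      apply lt_0_INR; lia.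
    + apply is_lim_seq_ext with
        (u := fun n => (1 + / INR (S n)) ^ m * Rabs x).
      * intros n.
        assert (Hn : 0 < INR (S n)) by (apply lt_0_INR; lia).
        replace (INR (S (S n)) ^ m * Rabs x ^ S (S n) /
                 (INR (S n) ^ m * Rabs x ^ S n))
          with ((1 + / INR (S n)) ^ m * Rabs x).
        { symmetry; apply Rabs_pos_eq, Rmult_le_pos; [|lra].
          apply pow_le. pose proof (Rinv_0_lt_compat _ Hn); lra. }
        replace (INR (S (S n))) with ((1 + / INR (S n)) * INR (S n))
          by (rewrite (S_INR (S n)); field; lra).
        rewrite Rpow_mult_distr, <- (tech_pow_Rmult _ (S n)).
        field; split; apply pow_nonzero; lra.
      * replace (Rabs x) with (1 ^ m * Rabs x) at 1 by (rewrite pow1; ring).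
        apply (is_lim_seq_scal_r _ (Rabs x) (Finite (1 ^ m))).
        apply (is_lim_seq_continuous (fun y => y ^ m)).
        { apply derivable_continuous_pt, derivable_pt_pow. }
        replace (Finite 1) with (Finite (1 + 0)) by (f_equal; ring).
        apply is_lim_seq_plus'; [apply is_lim_seq_const|].
        apply (is_lim_seq_incr_1 (fun n => / INR n)).
        apply (is_lim_seq_inv INR p_infty); [apply is_lim_seq_INR|easy].
Qed.

(* Series is total: this shows that the sum in the theorem is a genuine one for
   every |x| < 1. *)
Lemma ex_series_theorem1 (m : nat) (s : nat -> R) (x : R) :
  (forall j : nat, (j < m)%nat -> 0 < s j < 1) ->
  Rabs x < 1 ->
  ex_series (fun n : nat =>
    pochhammer (1 / 2) n
      * Rprod m (fun j => pochhammer (s j) n * pochhammer (1 - s j) n)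
      / INR (fact n) ^ (2 * m + 1)
      * INR n ^ m * x ^ n).
Proof.
  intros Hs Hx.
  apply (@ex_series_le R_AbsRing R_CompleteNormedModule)
    with (b := fun n => INR n ^ m * Rabs x ^ n);
    [|apply ex_series_pow_geom; assumption].
  intros n.
  destruct (pochhammer_bound (1 / 2) n) as [A1 A2]; [lra|].
  destruct (Rprod_pochhammer_bound m n s Hs) as [B1 B2].
  set (a := pochhammer (1 / 2) n) in *; set (P := Rprod m _) in *.
  pose proof (INR_fact_lt_0 n) as HF.
  assert (HFm : 0 < INR (fact n) ^ (2 * m + 1)) by (apply pow_lt; assumption).
  change (norm ?y) with (Rabs y).
  rewrite !Rabs_mult, <- (RPow_abs x n), (Rabs_pos_eq (INR n ^ m))
    by apply pow_le, pos_INR.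
  rewrite <- (Rmult_1_l (INR n ^ m * Rabs x ^ n)), Rmult_assoc.
  apply Rmult_le_compat_r.
  { apply Rmult_le_pos; apply pow_le; [apply pos_INR|apply Rabs_pos]. }
  assert (HaP : 0 < a * P) by (apply Rmult_lt_0_compat; assumption).
  rewrite Rabs_pos_eq.
  - apply Rmult_le_reg_r with (1 := HFm).
    unfold Rdiv; rewrite Rmult_assoc, Rinv_l, Rmult_1_r, Rmult_1_l by lra.
    rewrite pow_add, pow_1, Rmult_comm.
    apply Rmult_le_compat; lra.
  - apply Rlt_le, Rdiv_lt_0_compat; assumption.
Qed.

(* Main.v *)
(** The coefficient is [(1/2)_n / n!] times [m] factors
    [n (s)_n (1-s)_n / n!^2 = s (1 - s/n) prod_(0<k<n) (1 - s^2/k^2)], each of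
    which tends to [sin (pi s) / pi] by Euler's product. That product comes from
    [J_n(s) = int_0^(pi/2) cos (2st) cos^(2n) t dt]: integrating by parts twice
    gives [(1 - s^2/n^2) J_n(s) = (1 - 1/(2n)) J_(n-1)(s)], while
    [J_n(s) / J_n(0)] tends to 1 because the mass of [cos^(2n)] concentrates
    at 0. Finally the series of [(1/2)_n / n! x^n] sums to [(1-x)^(-1/2)], so
    multiplication by [sqrt (1-x)] yields weighted means of the product of the
    [m] factors, and the weight moves to infinity as [x] tends to 1. *)

Require Import Defs.
From Stdlib Require Import Reals Factorial Lra Lia.
From Coquelicot Require Import Coquelicot.
Open Scope R_scope.

(** * Moments of powers of the cosine and their recursion in the exponent *)

Definition cos_moment (s : R) (n : nat) : R :=
  RInt (fun t => cos (2 * s * t) * cos t ^ (2 * n)) 0 (PI / 2).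

Lemma continuous_cos_moment (s : R) (n : nat) (t : R) :
  continuous (fun t => cos (2 * s * t) * cos t ^ (2 * n)) t.
Proof.
  apply (ex_derive_continuous (V := R_NormedModule)); auto_derive; trivial.
Qed.

Lemma is_RInt_cos_moment (s : R) (n : nat) :
  is_RInt (fun t => cos (2 * s * t) * cos t ^ (2 * n)) 0 (PI / 2)
    (cos_moment s n).
Proof.
  apply (RInt_correct (V := R_CompleteNormedModule)), ex_RInt_continuous.
  intros; apply continuous_cos_moment.
Qed.

Lemma cos_moment_rec (s : R) (k : nat) :
  (1 - s ^ 2 / INR (S k) ^ 2) * cos_moment s (S k)
  = (2 * INR k + 1) / (2 * INR k + 2) * cos_moment s k.
Proof.
  assert (H : is_RInt (fun t =>
      ((2 * INR k + 2) ^ 2 - 4 * s ^ 2) * (cos (2 * s * t) * cos t ^ (2 * S k))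
      - (2 * INR k + 2) * (2 * INR k + 1) * (cos (2 * s * t) * cos t ^ (2 * k)))
      0 (PI / 2) 0).
  { (* [F] collects the boundary terms of two integrations by parts. *)
    pose (F := fun t => (2 * INR k + 2) * (cos (2 * s * t) * cos t ^ (2 * k + 1) * sin t)
      - 2 * s * (sin (2 * s * t) * cos t ^ (2 * k + 2))).
    replace 0 with (minus (F (PI / 2)) (F 0)) at 2.
    2:{ unfold F, minus, plus, opp; simpl.
        rewrite cos_PI2, Rmult_0_r, sin_0, !pow_i by lia; ring. }
    apply (is_RInt_derive (V := R_CompleteNormedModule)).
    - intros t _; unfold F; auto_derive; [trivial|].
      replace (2 * S k)%nat with (S (S (2 * k))) by lia.
      replace (k + (k + 0) + 1)%nat with (S (2 * k)) by lia.
      replace (k + (k + 0) + 2)%nat with (S (S (2 * k))) by lia.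
      rewrite !S_INR, mult_INR.
      cbn [Nat.pred pow]; simpl (INR 2).
      pose proof (sin2_cos2 t) as E; unfold Rsqr in E.
      set (c := cos t) in *; set (q := c ^ (2 * k)).
      (* The derivative of [F] and the integrand differ by a multiple of sin^2 + cos^2 - 1, which is
         made explicit so that [ring] can finish. *)
      apply Rminus_diag_uniq.
      replace 0 with (- (2 * INR k + 2) * (2 * INR k + 1) * cos (2 * s * t) * q
        * (sin t * sin t + c * c - 1)) by (rewrite E; ring).
      ring.
    - intros t _; apply (ex_derive_continuous (V := R_NormedModule));
        auto_derive; trivial. }
  pose proof (is_RInt_minus _ _ _ _ _ _
    (is_RInt_scal _ _ _ ((2 * INR k + 2) ^ 2 - 4 * s ^ 2) _ (is_RInt_cos_moment s (S k)))
    (is_RInt_scal _ _ _ ((2 * INR k + 2) * (2 * INR k + 1)) _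
      (is_RInt_cos_moment s k))) as H'.
  apply (is_RInt_unique (V := R_CompleteNormedModule)) in H, H'.
  pose proof (eq_trans (eq_sym H') H) as E.
  unfold minus, plus, opp, scal in E; simpl in E; unfold mult in E; simpl in E.
  pose proof (pos_INR k); rewrite S_INR.
  (* This factor turns 1 - s^2/(k+1)^2 into (2k+2)^2 - 4 s^2, the coefficient in the integral
     identity. *)
  apply Rmult_eq_reg_l with ((2 * INR k + 2) ^ 2); [|nra].
  transitivity (((2 * INR k + 2) ^ 2 - 4 * s ^ 2) * cos_moment s (S k)).
  - field; lra.
  - transitivity ((2 * INR k + 2) * (2 * INR k + 1) * cos_moment s k).
    + simpl in *; lra.
    + field; lra.
Qed.

Lemma cos_moment_zero_rec (k : nat) :
  cos_moment 0 (S k) = (2 * INR k + 1) / (2 * INR k + 2) * cos_moment 0 k.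
Proof.
  rewrite <- cos_moment_rec; field; apply not_0_INR; lia.
Qed.

Lemma cos_moment_0 (s : R) : s <> 0 -> cos_moment s 0 = sin (PI * s) / (2 * s).
Proof.
  intros Hs; apply (is_RInt_unique (V := R_CompleteNormedModule)).
  pose (F := fun t => sin (2 * s * t) / (2 * s)).
  replace (sin (PI * s) / (2 * s)) with (minus (F (PI / 2)) (F 0)).
  - apply (is_RInt_derive (V := R_CompleteNormedModule)).
    + intros t _; unfold F; auto_derive; [trivial|]. simpl; field; assumption.
    + intros; apply continuous_cos_moment.
  - unfold F, minus, plus, opp; simpl.
    rewrite Rmult_0_r, sin_0.
    replace (2 * s * (PI / 2)) with (PI * s) by field.
    field; assumption.
Qed.

Lemma cos_moment_0_0 : cos_moment 0 0 = PI / 2.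
Proof.
  unfold cos_moment.
  rewrite (RInt_ext _ (fun _ => 1)).
  - rewrite RInt_const; unfold scal; simpl; unfold mult; simpl; ring.
  - intros t _; replace (2 * 0 * t) with 0 by ring; rewrite cos_0; simpl; ring.
Qed.

(** * Partial products of Euler's sine product *)

Definition sine_product (s : R) (n : nat) : R :=
  Rprod n (fun k => 1 - s ^ 2 / INR (S k) ^ 2).

(** The recursions at [s] and at 0 share the factor (2k+1)/(2k+2), so their quotient telescopes. The
    cross-multiplied form avoids assuming that the moments at [s] are nonzero. *)
Lemma sine_product_cos_moment (s : R) (n : nat) :
  sine_product s n * cos_moment s n * cos_moment 0 0
  = cos_moment 0 n * cos_moment s 0.
Proof.
  induction n as [|n IH]; unfold sine_product in *; cbn [Rprod]; [ring|].
  pose proof (cos_moment_rec s n) as E.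
  rewrite cos_moment_zero_rec.
  rewrite (Rmult_assoc (Rprod n _)), E.
  rewrite (Rmult_assoc (_ / _) (cos_moment 0 n)), <- IH; ring.
Qed.

(** * Comparison of the moments at [s] with those at 0 *)

Lemma cos_moment_0_pos (n : nat) : 0 < cos_moment 0 n.
Proof.
  induction n as [|n IH].
  - rewrite cos_moment_0_0; pose proof PI_RGT_0; lra.
  - rewrite cos_moment_zero_rec; pose proof (pos_INR n).
    apply Rmult_lt_0_compat; [apply Rdiv_lt_0_compat|]; lra.
Qed.

Lemma cos_moment_le (s : R) (n : nat) : cos_moment s n <= cos_moment 0 n.
Proof.
  pose proof PI_RGT_0.
  apply RInt_le; [lra|eexists; apply is_RInt_cos_moment..|].
  intros t Ht; apply Rmult_le_compat_r.
  - apply pow_le, cos_ge_0; lra.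
  - replace (2 * 0 * t) with 0 by ring; rewrite cos_0; apply COS_bound.
Qed.

(** The difference sin t - t cos t vanishes at 0 and has derivative t sin t >= 0. *)
Lemma mul_cos_le_sin (t : R) : 0 <= t <= PI / 2 -> t * cos t <= sin t.
Proof.
  intros Ht.
  destruct (MVT_gen (fun t => sin t - t * cos t) 0 t (fun t => t * sin t))
    as [c [Hc E]].
  - intros x Hx; auto_derive; [trivial|ring].
  - intros x Hx; apply derivable_continuous_pt, ex_derive_Reals_0; auto_derive; trivial.
  - rewrite Rmin_left, Rmax_right in Hc by lra.
    rewrite sin_0 in E.
    assert (0 <= sin c) by (apply sin_ge_0; lra).
    assert (0 <= c * sin c) by nra. nra.
Qed.

(** With u = s t this is 1 - cos 2u = 2 sin^2 u together with |sin u| <= u for u >= 0. *)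
Lemma one_sub_cos_le (s t : R) : 0 <= s * t -> 1 - cos (2 * s * t) <= 2 * s ^ 2 * t ^ 2.
Proof.
  intros H; replace (2 * s * t) with (2 * (s * t)) by ring; rewrite cos_2a_sin.
  destruct (Req_dec (s * t) 0) as [E|E].
  - rewrite E, sin_0; nra.
  - assert (sin (s * t) < s * t) by (apply sin_lt_x; lra).
    assert (- (s * t) <= sin (s * t)).
    { destruct (Rle_lt_dec (s * t) PI) as [H1|H1].
      - pose proof (sin_ge_0 (s * t) H H1); lra.
      - pose proof (SIN_bound (s * t)); pose proof PI2_1; lra. }
    nra.
Qed.

(** Pointwise, (1 - cos 2st) cos^2 t <= 2 s^2 t^2 cos^2 t <= 2 s^2 sin^2 t; the index [S n] supplies
    the spare cos^2 t. Multiplying by cos^(2n) t and integrating bounds the defect by 2 s^2 (J_n(0)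
    - J_(n+1)(0)), and the recursion at 0 evaluates that difference as J_(n+1)(0) / (2n+1). *)
Lemma cos_moment_ge (s : R) (n : nat) : 0 <= s ->
  cos_moment 0 (S n) * (1 - 2 * s ^ 2 / (2 * INR n + 1)) <= cos_moment s (S n).
Proof.
  intros Hs. pose proof PI_RGT_0. pose proof (pos_INR n).
  pose proof (cos_moment_zero_rec n) as E0.
  replace (cos_moment 0 (S n) * (1 - 2 * s ^ 2 / (2 * INR n + 1)))
    with (cos_moment 0 (S n) - 2 * s ^ 2 * (cos_moment 0 n - cos_moment 0 (S n)))
    by (rewrite E0; field; lra).
  pose proof (is_RInt_minus _ _ _ _ _ _ (is_RInt_cos_moment 0 (S n))
    (is_RInt_scal _ _ _ (2 * s ^ 2) _
      (is_RInt_minus _ _ _ _ _ _ (is_RInt_cos_moment 0 n) (is_RInt_cos_moment 0 (S n)))))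
    as H'.
  unfold minus, plus, opp, scal in H'; simpl in H'; unfold mult in H'; simpl in H'.
  refine (is_RInt_le _ _ _ _ _ _ _ H' (is_RInt_cos_moment s (S n)) _); [lra|].
  intros t Ht; cbv beta.
  replace (2 * 0 * t) with 0 by ring; rewrite cos_0.
  replace (2 * S n)%nat with (S (S (2 * n))) by lia.
  replace (n + S (n + 0))%nat with (S (2 * n)) by lia.
  replace (n + (n + 0))%nat with (2 * n)%nat by lia.
  cbn [pow].
  assert (Hq : 0 <= cos t ^ (2 * n)) by (apply pow_le, cos_ge_0; lra).
  assert (Hc : 0 <= cos t) by (apply cos_ge_0; lra).
  pose proof (mul_cos_le_sin t ltac:(lra)) as H1.
  pose proof (one_sub_cos_le s t ltac:(nra)) as H2.
  pose proof (sin2_cos2 t) as E; unfold Rsqr in E.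
  set (q := cos t ^ (2 * n)) in *; set (c := cos t) in *.
  assert (H3 : t * t * (c * c) <= 1 - c * c).
  { assert (H3 : 0 <= t * c) by (apply Rmult_le_pos; lra).
    pose proof (Rmult_le_compat _ _ _ _ H3 H3 H1 H1); lra. }
  assert (H4 : (1 - cos (2 * s * t)) * (c * c) <= 2 * s ^ 2 * (1 - c * c)).
  { apply Rle_trans with (2 * s ^ 2 * t ^ 2 * (c * c)).
    - apply Rmult_le_compat_r; [nra|assumption].
    - pose proof (Rmult_le_compat_l (2 * s ^ 2) _ _ ltac:(nra) H3); lra. }
  assert (H5 : (1 - cos (2 * s * t)) * (c * c) * q <= 2 * s ^ 2 * (1 - c * c) * q)
    by (apply Rmult_le_compat_r; assumption).
  lra.
Qed.

(** * The limit of Euler's product *)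

Lemma is_lim_seq_inv_affine (a b c : R) :
  0 < b -> is_lim_seq (fun n => a / (b * INR n + c)) 0.
Proof.
  intros Hb.
  replace (Finite 0) with (Rbar_mult a (Rbar_inv p_infty)) by (simpl; f_equal; ring).
  apply (is_lim_seq_scal_l (fun n => / (b * INR n + c)) a).
  apply is_lim_seq_inv; [|easy].
  eapply is_lim_seq_plus; [|apply is_lim_seq_const|].
  - apply is_lim_seq_scal_l, is_lim_seq_INR.
  - unfold is_Rbar_plus, Rbar_mult; simpl.
    destruct (Rle_dec 0 b) as [h|h]; [|lra].
    destruct (Rle_lt_or_eq_dec 0 b h); [reflexivity|lra].
Qed.

Lemma is_lim_seq_sine_product (s : R) : 0 < s < 1 ->
  is_lim_seq (fun n => s * sine_product s n) (sin (PI * s) / PI).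
Proof.
  intros Hs. pose proof PI_RGT_0.
  apply is_lim_seq_incr_1.
  assert (Hr : is_lim_seq (fun n => cos_moment s (S n) / cos_moment 0 (S n)) 1).
  { apply is_lim_seq_le_le with (u := fun n => 1 - (2 * s ^ 2) / (2 * INR n + 1))
      (w := fun _ => 1).
    - intros n; pose proof (cos_moment_0_pos (S n)) as Hp; split.
      + apply Rle_div_r; [assumption|].
        rewrite Rmult_comm; apply cos_moment_ge; lra.
      + apply Rle_div_l; [assumption|].
        rewrite Rmult_1_l; apply cos_moment_le.
    - replace (Finite 1) with (Finite (1 - 0)) by (f_equal; ring).
      apply is_lim_seq_minus'; [apply is_lim_seq_const|].
      apply is_lim_seq_inv_affine; lra.
    - apply is_lim_seq_const. }
  assert (Hsin : 0 < sin (PI * s)) by (apply sin_gt_0; nra).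
  (* A zero moment would make the left side of the telescoped identity vanish, while its right side
     is positive because sin (pi s) > 0. *)
  assert (Hne : forall n, cos_moment s n <> 0).
  { intros n E; pose proof (sine_product_cos_moment s n) as E'.
    rewrite E, Rmult_0_r, Rmult_0_l, cos_moment_0 in E' by lra.
    pose proof (cos_moment_0_pos n).
    assert (0 < cos_moment 0 n * (sin (PI * s) / (2 * s))); [|lra].
    apply Rmult_lt_0_compat; [|apply Rdiv_lt_0_compat]; lra. }
  apply is_lim_seq_ext with
    (u := fun n => sin (PI * s) / PI * / (cos_moment s (S n) / cos_moment 0 (S n))).
  - intros n.
    pose proof (cos_moment_0_pos (S n)) as Hp.
    pose proof (sine_product_cos_moment s (S n)) as E.
    rewrite cos_moment_0_0, cos_moment_0 in E by lra.
    specialize (Hne (S n)).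
    assert (Hk : 0 < PI / 2 / s) by (repeat apply Rdiv_lt_0_compat; lra).
    (* Since J_0(0) = pi/2, this multiplier reduces the goal to the telescoped identity. *)
    apply Rmult_eq_reg_r with (cos_moment s (S n) * (PI / 2 / s)).
    + transitivity (cos_moment 0 (S n) * (sin (PI * s) / (2 * s))).
      * field; repeat split; lra.
      * rewrite <- E; field; lra.
    + apply Rmult_integral_contrapositive_currified; [assumption|lra].
  - replace (Finite (sin (PI * s) / PI)) with (Rbar_mult (sin (PI * s) / PI) (Rbar_inv 1))
      by (simpl; f_equal; field; lra).
    apply is_lim_seq_scal_l, is_lim_seq_inv; [assumption|].
    intros E; injection E; lra.
Qed.

(** * Pochhammer symbols in terms of the sine product *)

Lemma pochhammer_S (s : R) (n : nat) : pochhammer s (S n) = pochhammer s n * (s + INR n).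
Proof. reflexivity. Qed.

(** With N = n + 1, the factors k + s of (s)_N pair with k - s of (1-s)_N for 0 < k < N, leaving s
    and N - s unpaired. The denominator [1 * INR n + 1] has the shape required by
    [is_lim_seq_inv_affine]. *)
Lemma pochhammer_sine_product (s : R) (n : nat) :
  INR (S n) * (pochhammer s (S n) * pochhammer (1 - s) (S n)) / INR (fact (S n)) ^ 2
  = s * sine_product s n * (1 - s / (1 * INR n + 1)).
Proof.
  induction n as [|n IH].
  - unfold pochhammer, sine_product; simpl; field.
  - rewrite (pochhammer_S s (S n)), (pochhammer_S (1 - s) (S n)).
    unfold sine_product in *; cbn [Rprod].
    pose proof (INR_fact_neq_0 (S n)) as HF.
    rewrite (fact_simpl (S n)), mult_INR.
    set (F := INR (fact (S n))) in *.
    set (a := pochhammer s (S n)) in *; set (b := pochhammer (1 - s) (S n)) in *.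
    rewrite (S_INR (S n)), !S_INR in *; pose proof (pos_INR n).
    set (x := INR n) in *.
    (* The second factor is the quotient of the left sides at two consecutive indices. *)
    transitivity ((x + 1) * (a * b) / F ^ 2
       * ((s + (x + 1)) * (1 - s + (x + 1)) / ((x + 1) * (x + 1 + 1)))).
    + field; repeat split; lra.
    + rewrite IH; field; repeat split; lra.
Qed.

Lemma is_lim_seq_pochhammer_reflection (s : R) : 0 < s < 1 ->
  is_lim_seq
    (fun n => INR n * (pochhammer s n * pochhammer (1 - s) n) / INR (fact n) ^ 2)
    (sin (PI * s) / PI).
Proof.
  intros Hs; apply is_lim_seq_incr_1.
  eapply is_lim_seq_ext; [intros n; symmetry; apply pochhammer_sine_product|].
  replace (sin (PI * s) / PI) with (sin (PI * s) / PI * (1 - 0)) by ring.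
  apply is_lim_seq_mult'; [apply is_lim_seq_sine_product; assumption|].
  apply is_lim_seq_minus'; [apply is_lim_seq_const|].
  apply is_lim_seq_inv_affine; lra.
Qed.

Lemma is_lim_seq_Rprod (m : nat) (u : nat -> nat -> R) (l : nat -> R) :
  (forall j, (j < m)%nat -> is_lim_seq (u j) (l j)) ->
  is_lim_seq (fun n => Rprod m (fun j => u j n)) (Rprod m l).
Proof.
  induction m as [|m IH]; intros H; cbn [Rprod].
  - apply is_lim_seq_const.
  - apply is_lim_seq_mult'; [apply IH; intros; apply H; lia|apply H; lia].
Qed.

(** * The binomial series of (1-x)^(-1/2) *)

Definition binom_half (n : nat) : R := pochhammer (1 / 2) n / INR (fact n).

Lemma binom_half_bound (n : nat) : 0 < binom_half n <= 1.
Proof.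
  destruct (pochhammer_bound (1 / 2) n) as [H1 H2]; [lra|].
  pose proof (INR_fact_lt_0 n); unfold binom_half; split.
  - apply Rdiv_lt_0_compat; assumption.
  - apply Rle_div_l; [assumption|lra].
Qed.

Lemma binom_half_S (n : nat) :
  INR (S n) * binom_half (S n) = (INR n + 1 / 2) * binom_half n.
Proof.
  unfold binom_half; rewrite pochhammer_S, fact_simpl, mult_INR.
  field; split; [apply INR_fact_neq_0|apply not_0_INR; lia].
Qed.

Lemma CV_radius_binom_half (x : R) :
  Rabs x < 1 -> Rbar_lt (Rabs x) (CV_radius binom_half).
Proof.
  intros Hx; apply Rbar_lt_le_trans with 1; [exact Hx|].
  apply (proj1 (CV_radius_bounded binom_half)).
  exists 1; intros n; rewrite pow1, Rmult_1_r.
  pose proof (binom_half_bound n); rewrite Rabs_pos_eq; lra.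
Qed.

(* The recursion of the coefficients is the differential equation
   [(1 - x) f' = f / 2] for the sum [f]. *)
Lemma PSeries_binom_half_ode (x : R) : Rabs x < 1 ->
  (1 - x) * PSeries (PS_derive binom_half) x = / 2 * PSeries binom_half x.
Proof.
  intros Hx; pose proof (CV_radius_binom_half x Hx) as Hr.
  assert (E : PSeries (PS_derive binom_half) x
    = PSeries (PS_plus (PS_incr_1 (PS_derive binom_half)) (PS_scal (/ 2) binom_half)) x).
  { apply PSeries_ext; intros [|n]; unfold PS_derive; rewrite binom_half_S.
    - change ((INR 0 + 1 / 2) * binom_half 0 = 0 + / 2 * binom_half 0).
      simpl; field.
    - change ((INR (S n) + 1 / 2) * binom_half (S n)
        = INR (S n) * binom_half (S n) + / 2 * binom_half (S n)).
      field. }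
  rewrite PSeries_plus, PSeries_incr_1, PSeries_scal in E.
  - lra.
  - apply CV_radius_inside; rewrite CV_radius_incr_1, CV_radius_derive; assumption.
  - apply CV_radius_inside; rewrite CV_radius_scal by lra; assumption.
Qed.

(** By the differential equation, sqrt (1-x) times the sum has zero derivative, and its value at 0
    is 1. *)
Lemma binom_half_series (x : R) : 0 <= x < 1 ->
  sqrt (1 - x) * Series (fun n => binom_half n * x ^ n) = 1.
Proof.
  intros Hx.
  change (sqrt (1 - x) * PSeries binom_half x = 1).
  assert (E0 : sqrt (1 - 0) * PSeries binom_half 0 = 1).
  { rewrite PSeries_0, Rminus_0_r, sqrt_1; unfold binom_half, pochhammer; simpl; field. }
  (* The constancy criterion [eq_is_derive] needs a nondegenerate interval, so x = 0 is separate. *)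
  destruct (Req_dec x 0) as [->|Hx0]; [exact E0|].
  transitivity (sqrt (1 - 0) * PSeries binom_half 0); [symmetry|exact E0].
  apply (eq_is_derive (fun x => sqrt (1 - x) * PSeries binom_half x)); [|lra].
  intros t Ht.
  assert (Ht1 : Rabs t < 1) by (rewrite Rabs_pos_eq; lra).
  pose proof (is_derive_PSeries _ _ (CV_radius_binom_half t Ht1)) as Hd.
  assert (Hs : is_derive (fun t => sqrt (1 - t)) t (- / (2 * sqrt (1 - t)))).
  { auto_derive; [lra|]. unfold Rminus; field; apply Rgt_not_eq, sqrt_lt_R0; lra. }
  pose proof (is_derive_mult _ _ _ _ _ Hs Hd Rmult_comm) as H.
  replace (@zero R_NormedModule)
    with (plus (mult (- / (2 * sqrt (1 - t))) (PSeries binom_half t))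
      (mult (sqrt (1 - t)) (PSeries (PS_derive binom_half) t))); [exact H|].
  pose proof (PSeries_binom_half_ode t Ht1) as E.
  assert (Hq : 0 < sqrt (1 - t)) by (apply sqrt_lt_R0; lra).
  pose proof (sqrt_sqrt (1 - t) ltac:(lra)) as Hqq.
  unfold plus, mult, zero; simpl.
  apply Rmult_eq_reg_l with (sqrt (1 - t)); [|lra].
  rewrite <- Hqq in E.
  transitivity (sqrt (1 - t) * sqrt (1 - t) * PSeries (PS_derive binom_half) t
    - / 2 * PSeries binom_half t); [field; lra|lra].
Qed.

Lemma ex_series_binom_half (x : R) : 0 <= x < 1 ->
  ex_series (fun n => binom_half n * x ^ n).
Proof.
  intros Hx; apply ex_pseries_R, CV_radius_inside, CV_radius_binom_half.
  rewrite Rabs_pos_eq; lra.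
Qed.

(** * An Abelian theorem for the weighted means *)

Lemma ex_series_finite_support (u : nat -> R) (N : nat) :
  (forall n, (N <= n)%nat -> u n = 0) -> ex_series u.
Proof.
  intros H; apply (ex_series_incr_n u N).
  apply ex_series_ext with (a := fun n => 0 * (/ 2) ^ n).
  - intros n; rewrite H by lia; exact (Rmult_0_l _).
  - apply (ex_series_scal_l 0 (fun n => (/ 2) ^ n)), ex_series_geom.
    rewrite Rabs_pos_eq; lra.
Qed.

(** Used to make finitely many error terms negligible. As [sqrt] is 0 on negative reals, the
    function is continuous at 1 from both sides, and the limit is then restricted to the left. *)
Lemma filterlim_sqrt_one_sub_0 (c : R) :
  filterlim (fun x => sqrt (1 - x) * c) (at_left 1) (locally 0).
Proof.
  assert (C : continuous (fun x => sqrt (1 - x) * c) 1).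
  { apply (continuous_mult (fun x => sqrt (1 - x)) (fun _ => c));
      [|apply continuous_const].
    apply (continuous_comp (fun x => 1 - x) sqrt); [|apply continuous_sqrt].
    apply (continuous_minus (fun _ => 1) (fun x => x));
      [apply continuous_const|apply continuous_id]. }
  unfold continuous in C; rewrite Rminus_diag, sqrt_0, Rmult_0_l in C.
  apply filterlim_filter_le_1 with (2 := C), filter_le_within.
Qed.

(* Since the weights [sqrt (1 - x) * binom_half n * x ^ n] have sum 1 and each
   of them tends to 0, only the tail of [c] matters. *)
Lemma abelian_binom_half (c : nat -> R) (l : R) : is_lim_seq c l ->
  filterlim (fun x => sqrt (1 - x) * Series (fun n => binom_half n * c n * x ^ n))
    (at_left 1) (locally l).
Proof.
  intros Hc; apply filterlim_locally; intros eps.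
  apply is_lim_seq_spec in Hc.
  destruct (Hc (pos_div_2 eps)) as [N HN]; simpl in HN.
  (* The weights [binom_half n * x ^ n] are at most 1 for x in (0,1), so [h] bounds the first [N]
     error terms uniformly in [x]. *)
  pose (h := fun n => if Nat.ltb n N then Rabs (c n - l) else 0).
  assert (Hh : ex_series h).
  { apply ex_series_finite_support with N; intros n Hn; unfold h.
    destruct (Nat.ltb_spec n N); [lia|reflexivity]. }
  pose proof (filterlim_sqrt_one_sub_0 (Series h)) as Hz.
  pose proof (proj1 (filterlim_locally _ _) Hz (pos_div_2 eps)) as Hz'.
  assert (Hpos : at_left 1 (fun x => 0 < x)).
  { exists (mkposreal 1 Rlt_0_1); intros y Hy _.
    apply Rabs_def2 in Hy; unfold minus, plus, opp in Hy; simpl in Hy; lra. }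
  assert (Hlt : at_left 1 (fun x => x < 1)).
  { exists (mkposreal 1 Rlt_0_1); intros y _ Hy; exact Hy. }
  generalize (filter_and _ _ Hz' (filter_and _ _ Hpos Hlt)).
  apply filter_imp; intros x [Hb [Hx0 Hx1]].
  change (Rabs (sqrt (1 - x) * Series h - 0) < eps / 2) in Hb.
  change (Rabs (sqrt (1 - x) * Series (fun n => binom_half n * c n * x ^ n) - l) < eps).
  rewrite Rminus_0_r in Hb; apply Rabs_def2 in Hb.
  assert (Hx : 0 <= x < 1) by lra.
  pose proof (binom_half_series x Hx) as E1.
  pose proof (ex_series_binom_half x Hx) as Ha.
  pose (d := fun n => binom_half n * (c n - l) * x ^ n).
  (* This dominates |d|: [h] covers n < N, and eps/2 times the weight covers the tail. After
     multiplication by sqrt (1-x) its sum is eps/2 plus the small quantity of [Hb]. *)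
  pose (g := fun n => eps / 2 * (binom_half n * x ^ n) + h n).
  assert (Hg1 : ex_series (fun n => eps / 2 * (binom_half n * x ^ n)))
    by apply (ex_series_scal_l (eps / 2) _ Ha).
  assert (Hg : ex_series g) by exact (ex_series_plus _ _ Hg1 Hh).
  assert (Hdg : forall n, Rabs (d n) <= g n).
  { intros n; unfold d, g, h.
    destruct (binom_half_bound n) as [B1 B2].
    assert (P1 : 0 <= x ^ n) by (apply pow_le; lra).
    assert (P2 : x ^ n <= 1) by (rewrite <- (pow1 n); apply pow_incr; lra).
    rewrite !Rabs_mult, (Rabs_pos_eq (x ^ n)), (Rabs_pos_eq (binom_half n)) by lra.
    pose proof (Rabs_pos (c n - l)); pose proof (cond_pos eps).
    assert (0 <= binom_half n * x ^ n <= 1) by nra.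
    destruct (Nat.ltb_spec n N) as [Hn|Hn]; [nra|].
    specialize (HN n Hn); nra. }
  assert (Hda : ex_series (fun n => Rabs (d n))).
  { apply (@ex_series_le R_AbsRing R_CompleteNormedModule) with (b := g); [|exact Hg].
    intros n; change (norm ?y) with (Rabs y); rewrite Rabs_Rabsolu; apply Hdg. }
  assert (Hd : ex_series d) by (apply ex_series_Rabs; exact Hda).
  assert (E2 : Series (fun n => binom_half n * c n * x ^ n)
    = Series d + l * Series (fun n => binom_half n * x ^ n)).
  { rewrite <- Series_scal_l, <- Series_plus.
    - apply Series_ext; intros n; unfold d; ring.
    - exact Hd.
    - apply (ex_series_scal_l l _ Ha). }
  assert (E3 : Series g = eps / 2 * Series (fun n => binom_half n * x ^ n) + Series h).
  { unfold g; rewrite Series_plus, Series_scal_l by assumption; reflexivity. }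
  assert (Hle : Rabs (Series d) <= Series g).
  { apply Rle_trans with (1 := Series_Rabs d Hda).
    apply Series_le; [|exact Hg]; intros n; split; [apply Rabs_pos|apply Hdg]. }
  pose proof (sqrt_pos (1 - x)) as Hq.
  rewrite E2; rewrite E3 in Hle.
  set (q := sqrt (1 - x)) in *; set (A := Series (fun n => binom_half n * x ^ n)) in *.
  (* The total weight q A is 1, so the constant [l] cancels. *)
  replace (q * (Series d + l * A) - l) with (q * Series d)
    by (transitivity (q * Series d + l * (q * A) - l); [rewrite E1|]; ring).
  rewrite Rabs_mult, (Rabs_pos_eq q) by assumption.
  apply Rle_lt_trans with (q * (eps / 2 * A + Series h));
    [apply Rmult_le_compat_l; assumption|].
  replace (q * (eps / 2 * A + Series h)) with (eps / 2 * (q * A) + q * Series h) by ring.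
  rewrite E1; lra.
Qed.

(** * Matching the coefficients and conclusion *)

Lemma Rprod_pochhammer_normalised (m n : nat) (s : nat -> R) :
  Rprod m (fun j => INR n * (pochhammer (s j) n * pochhammer (1 - s j) n)
    / INR (fact n) ^ 2)
  = Rprod m (fun j => pochhammer (s j) n * pochhammer (1 - s j) n)
    / INR (fact n) ^ (2 * m) * INR n ^ m.
Proof.
  pose proof (INR_fact_neq_0 n) as HF.
  induction m as [|m IH]; [simpl; field|].
  replace (2 * S m)%nat with (2 + 2 * m)%nat by lia.
  cbn [Rprod]; rewrite IH, pow_add, <- (tech_pow_Rmult (INR n)).
  field; split; [apply pow_nonzero|]; assumption.
Qed.

Theorem theorem1 (m : nat) (s : nat -> R)
  (hm : (0 < m)%nat)
  (hs : forall j : nat, (j < m)%nat -> 0 < s j < 1) :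
  filterlim
    (fun x : R =>
       sqrt (1 - x) *
       Series (fun n : nat =>
         pochhammer (1 / 2) n
           * Rprod m (fun j => pochhammer (s j) n * pochhammer (1 - s j) n)
           / INR (fact n) ^ (2 * m + 1)
           * INR n ^ m * x ^ n))
    (at_left 1)
    (locally (Rprod m (fun j => sin (PI * s j) / PI))).
Proof.
  (* Proving the limit first fixes the unknown function as a series in [binom_half]. The
     coefficients then agree: 2m of the 2m + 1 factors n! go to the product, and the last one to
     [binom_half]. *)
  eapply filterlim_ext; cycle 1.
  - apply abelian_binom_half, is_lim_seq_Rprod.
    intros j Hj; apply is_lim_seq_pochhammer_reflection, hs, Hj.
  - intros x; cbv beta; f_equal; apply Series_ext; intros n.
    rewrite Rprod_pochhammer_normalised, pow_add, pow_1; unfold binom_half.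
    field; split; [|apply pow_nonzero]; apply INR_fact_neq_0.
Qed.
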